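(* Let $G$ be a discrete group with the property that the set $R_g$ of roots of $g$ in $G$ is finite for all $g\in G$. Then the complement (in $\mathrm{Sub}^c_G$) of any neighbourhood of $\{e\}$ in $\mathrm{Sub}^c_G$ is finite. Moreover, $G$ does not admit any automorphism which acts expansively on $\mathrm{Sub}^c_G$ unless $G$ is finite.
   Context: For $g\in G$, $R_g=\{y\in G\mid y^n=g\text{ for some }n\in\mathbb{N}\}$, with $\mathbb{N}=\{1,2,\dots\}$; $e$ is the identity of $G$. For a discrete group $G$, $\mathrm{Sub}_G$ is the set of all subgroups of $G$ with the Chabauty topology, which has as sub-basis the sets $\{A\in\mathrm{Sub}_G\mid A\cap K=\emptyset\}$ with $K\subset G$ finite and $\{A\in\mathrm{Sub}_G\mid A\cap U\ne\emptyset\}$ with $U\subset G$ arbitrary; it is compact Hausdorff. Standing assumption: all topological spaces considered, including $\mathrm{Sub}_G$, are metrizable. $\mathrm{Sub}^c_G$ is the subspace of cyclic subgroups of $G$. Each $T\in\mathrm{Aut}(G)$ induces a homeomorphism $H\mapsto T(H)$ of $\mathrm{Sub}_G$ preserving $\mathrm{Sub}^c_G$; $T$ acts expansively on $\mathrm{Sub}^c_G$ if this homeomorphism of $\mathrm{Sub}^c_G$ is expansive. A homeomorphism $S$ of a metrizable space $X$ with metric $d$ is expansive if there exists $\delta>0$ such that for all $x\ne y$ in $X$ there is $n\in\mathbb{Z}$ with $d(S^n(x),S^n(y))>\delta$; for compact $X$ this does not depend on the choice of compatible metric. *)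

(* Defs.v *)
From HB Require Import structures.
From mathcomp Require Import all_boot all_order all_algebra.
From mathcomp Require Import all_classical all_reals all_analysis.

Set Implicit Arguments.
Unset Strict Implicit.
Unset Printing Implicit Defensive.

Import Order.TTheory GRing.Theory Num.Theory.
Local Open Scope classical_set_scope.
Local Open Scope ring_scope.

Definition root_set (G : groupType) (g : G) : set G :=
  [set y | exists2 n : nat, (0 < n)%N & (y ^+ n)%g = g].

Record subgroup (G : groupType) := Subgroup {
  subgroup_set :> set G;
  subgroup1 : subgroup_set 1%g;
  subgroupM : forall x y, subgroup_set x -> subgroup_set y ->
    subgroup_set (x * y)%g;
  subgroupV : forall x, subgroup_set x -> subgroup_set (x^-1)%g }.

Lemma subgroup_inj (G : groupType) : injective (@subgroup_set G).
Proof.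
move=> [A A1 AM AV] [B B1 BM BV] /= AB; case: _ / AB in B1 BM BV *.
by congr Subgroup; exact: Prop_irrelevance.
Qed.

HB.instance Definition _ (G : groupType) := gen_eqMixin (subgroup G).
HB.instance Definition _ (G : groupType) := gen_choiceMixin (subgroup G).

(* The usual sub-basis of the Chabauty topology specializes to this one because
   in a discrete group the compact sets are the finite ones and every set is
   open. *)
Definition chabauty_subbase (G : groupType) : set (set (subgroup G)) :=
  [set [set A : subgroup G | A `&` K = set0] | K in @finite_set G]
  `|` [set [set A : subgroup G | A `&` U !=set0] | U in [set: set G]].

HB.instance Definition _ (G : groupType) :=
  @isSubBaseTopological.Build (subgroup G)
    (set (subgroup G)) (@chabauty_subbase G) id.

Definition is_cyclic (G : groupType) (H : subgroup G) : Prop :=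
  exists x : G, H = [set y | exists n : nat, y = (x ^+ n)%g \/ y = (x ^- n)%g]
    :> set G.

Definition cyclic_subgroup (G : groupType) :=
  set_type [set H : subgroup G | is_cyclic H].

HB.instance Definition _ (G : groupType) :=
  Topological.copy (cyclic_subgroup G)
    (set_type [set H : subgroup G | is_cyclic H]).

Section Trivial.
Variable G : groupType.

Lemma trivial1M (x y : G) : [set 1%g] x -> [set 1%g] y -> [set 1%g] (x * y)%g.
Proof. by move=> -> ->; rewrite /= mulg1. Qed.

Lemma trivial1V (x : G) : [set 1%g] x -> [set 1%g] (x^-1)%g.
Proof. by move=> ->; rewrite /= invg1. Qed.

Definition trivial_subgroup : subgroup G :=
  @Subgroup G [set 1%g] erefl trivial1M trivial1V.

Lemma trivial_subgroup_cyclic : is_cyclic trivial_subgroup.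
Proof.
exists 1%g; apply/seteqP; split=> y /=.
  by move=> ->; exists 0%N; left.
by move=> [n []] ->; rewrite expg1n ?invg1.
Qed.

Definition trivial_cyclic : cyclic_subgroup G :=
  exist _ trivial_subgroup (mem_set trivial_subgroup_cyclic).

End Trivial.

Record homeomorphism (X : topologicalType) := Homeomorphism {
  homeo :> X -> X;
  homeoV : X -> X;
  homeoK : cancel homeo homeoV;
  homeoVK : cancel homeoV homeo;
  homeo_continuous : continuous homeo;
  homeoV_continuous : continuous homeoV }.

(* [Negz m] is the integer [- (m + 1)]. *)
Definition homeo_iter (X : topologicalType) (S : homeomorphism X) (n : int) :
    X -> X :=
  match n with
  | Posz m => iter m S
  | Negz m => iter m.+1 (homeoV S)
  end.

Record compatible_metric (R : realType) (X : topologicalType)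
    (d : X -> X -> R) : Prop := CompatibleMetric {
  metric_eq0 : forall x y, d x y = 0 <-> x = y;
  metric_symm : forall x y, d x y = d y x;
  metric_trian : forall x y z, d x z <= d x y + d y z;
  metric_nbhs : forall (x : X) (V : set X),
    nbhs x V <-> exists2 r : R, 0 < r & [set y | d x y < r] `<=` V }.

Definition metrizable (R : realType) (X : topologicalType) : Prop :=
  exists d : X -> X -> R, compatible_metric d.

Definition expansive_for (R : realType) (X : topologicalType)
    (d : X -> X -> R) (S : homeomorphism X) : Prop :=
  exists2 delta : R, 0 < delta & forall x y : X, x <> y ->
    exists n : int, delta < d (homeo_iter S n x) (homeo_iter S n y).

(* On a compact space the choice of the compatible metric is irrelevant. *)
Definition expansive (R : realType) (X : topologicalType)
    (S : homeomorphism X) : Prop :=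
  exists2 d : X -> X -> R, compatible_metric d & expansive_for d S.

Record automorphism (G : groupType) := Automorphism {
  aut :> {multiplicative G -> G};
  autV : G -> G;
  autK : cancel aut autV;
  autVK : cancel autV aut }.

Section Inverse.
Variables (G : groupType) (T : automorphism G).

Lemma autV_mul : {morph autV T : x y / (x * y)%g}.
Proof.
by move=> x y; apply: (can_inj (autK T)); rewrite autVK gmulfM !autVK.
Qed.

HB.instance Definition _ := isMultiplicative.Build G G (autV T) autV_mul.

Definition aut_inv : automorphism G :=
  @Automorphism G (autV T) T (autVK T) (autK T).

End Inverse.

Section Action.
Variables (G : groupType) (T : automorphism G).

Lemma aut1 : T 1%g = 1%g.
Proof. by apply: (mulgI (T 1%g)); rewrite -gmulfM !mulg1. Qed.

Lemma autVg x : T (x^-1)%g = ((T x)^-1)%g.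
Proof. by apply: (mulgI (T x)); rewrite -gmulfM !mulgV aut1. Qed.

Lemma autXg x n : T (x ^+ n)%g = ((T x) ^+ n)%g.
Proof. by elim: n => [|n IH]; rewrite ?expg0 ?aut1// !expgS gmulfM IH. Qed.

Variable H : subgroup G.

Lemma aut_image1 : (T @` H) 1%g.
Proof. by exists 1%g; [exact: subgroup1|exact: aut1]. Qed.

Lemma aut_imageM x y : (T @` H) x -> (T @` H) y -> (T @` H) (x * y)%g.
Proof.
move=> [a Ha <-] [b Hb <-]; exists (a * b)%g; last exact: gmulfM.
exact: subgroupM.
Qed.

Lemma aut_imageV x : (T @` H) x -> (T @` H) (x^-1)%g.
Proof.
by move=> [a Ha <-]; exists (a^-1)%g; [exact: subgroupV|exact: autVg].
Qed.

Definition aut_image : subgroup G :=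
  Subgroup aut_image1 aut_imageM aut_imageV.

Lemma aut_image_cyclic : is_cyclic H -> is_cyclic aut_image.
Proof.
move=> [x Hx]; exists (T x); apply/seteqP; split=> y /=.
  move=> [a]; rewrite Hx => -[n [] ->] <-; exists n.
    by left; exact: autXg.
  by right; rewrite autVg autXg.
move=> [n [] ->].
  by exists (x ^+ n)%g; [rewrite Hx; exists n; left|exact: autXg].
exists (x ^- n)%g; first by rewrite Hx; exists n; right.
by rewrite autVg autXg.
Qed.

End Action.

Lemma aut_imageK (G : groupType) (T : automorphism G) :
  cancel (aut_image T) (aut_image (aut_inv T)).
Proof.
move=> H; apply: subgroup_inj; apply/seteqP; split=> y /=.
  by move=> [_ [a Ha <-] <-]; rewrite /= autK.
by move=> Hy; exists (T y); [exists y|rewrite /= autK].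
Qed.

Lemma aut_imageVK (G : groupType) (T : automorphism G) :
  cancel (aut_image (aut_inv T)) (aut_image T).
Proof.
move=> H; apply: subgroup_inj; apply/seteqP; split=> y /=.
  by move=> [_ [a Ha <-] <-]; rewrite /= autVK.
by move=> Hy; exists (autV T y); [exists y|rewrite /= autVK].
Qed.

Lemma subbase_continuous (X : topologicalType) (G : groupType)
    (f : X -> subgroup G) :
  (forall B, chabauty_subbase B -> open (f @^-1` B)) -> continuous f.
Proof.
move=> fB; apply/continuousP => _ [D' sD' <-].
rewrite preimage_bigcup; apply: bigcup_open => _ /sD'[I sI <-].
rewrite preimage_bigcap bigcap_fset.
rewrite big_seq; apply: (big_ind (@open X)) => [|A B|B BI].
- exact: openT.
- exact: openI.
- by apply: fB; have := sI _ BI; rewrite inE.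
Qed.

Lemma subbase_open (G : groupType) (B : set (subgroup G)) :
  chabauty_subbase B -> open B.
Proof.
move=> DB; exists [set B]; last by rewrite bigcup_set1.
by move=> _ ->; exact: finI_from1.
Qed.

Lemma aut_image_continuous (G : groupType) (T : automorphism G) :
  continuous (aut_image T).
Proof.
apply: subbase_continuous => B DB; apply: subbase_open.
have TI (H : subgroup G) (K : set G) :
    ((aut_image T H : set G) `&` K = set0) <->
    ((H : set G) `&` T @^-1` K = set0).
  split=> /seteqP[H0 _]; apply/seteqP; split=> // y /= [].
    by move=> Hy Ky; apply: (H0 (T y)); split=> //; exists y.
  by move=> [x Hx <-] Kx; exact: (H0 x).
case: DB => -[K Kfin <-].
  left; exists (T @^-1` K); last by apply/seteqP; split=> H /= /TI.
  apply: finite_preimage => //; first by move=> x y _ _ /(can_inj (autK T)).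
right; exists (T @^-1` K) => //; apply/seteqP; split=> H /= /set0P/eqP HK;
  by apply/set0P/eqP => /TI.
Qed.

Section CyclicAction.
Variables (G : groupType) (T : automorphism G).

Definition cyclic_image (H : cyclic_subgroup G) : cyclic_subgroup G :=
  exist _ (aut_image T (set_val H))
    (mem_set (aut_image_cyclic T (set_valP H))).

Lemma cyclic_image_continuous : continuous cyclic_image.
Proof.
apply/continuousP => _ [B oB <-].
exists (aut_image T @^-1` B) => //.
by move/continuousP: (aut_image_continuous (T := T)); exact.
Qed.

End CyclicAction.

Section CyclicHomeo.
Variables (G : groupType) (T : automorphism G).

Lemma cyclic_imageK : cancel (cyclic_image T) (cyclic_image (aut_inv T)).
Proof. by move=> H; apply: val_inj; exact: aut_imageK. Qed.

Lemma cyclic_imageVK : cancel (cyclic_image (aut_inv T)) (cyclic_image T).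
Proof. by move=> H; apply: val_inj; exact: aut_imageVK. Qed.

Definition cyclic_homeo : homeomorphism (cyclic_subgroup G) :=
  Homeomorphism cyclic_imageK cyclic_imageVK
    (@cyclic_image_continuous G T) (@cyclic_image_continuous G (aut_inv T)).

End CyclicHomeo.

Definition acts_expansively (R : realType) (G : groupType)
    (T : automorphism G) : Prop :=
  expansive R (cyclic_homeo T).

(* Main.v *)
Require Import Defs.
From HB Require Import structures.
From mathcomp Require Import all_boot all_order all_algebra.
From mathcomp Require Import all_classical all_reals all_analysis.

Set Implicit Arguments.
Unset Strict Implicit.
Unset Printing Implicit Defensive.

Local Open Scope classical_set_scope.

(** Complements of neighbourhoods of the trivial subgroup.  A sub-basic set
    that contains the trivial subgroup is either everything (a hitting set
    whose test set contains 1) or a set of subgroups missing a finite K with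
    1 not in K.  A cyclic subgroup that meets K contains some g in K, hence is
    generated by a root of g, so that only finitely many of them exist
    ([cyclic_meeting_finite]).

    Expansive automorphisms.  Suppose that T acts expansively with constant
    delta.  The trivial subgroup is a fixed point, so comparing a non-trivial
    cyclic subgroup with it shows that the orbit of every non-trivial point
    meets the complement of the delta-ball around the trivial subgroup, which
    is finite by the first part ([expansive_orbits_meet_finite]).  If G is
    infinite, it has an element g of infinite order, because the torsion
    elements are the roots of 1.  By the pigeonhole principle two of the
    subgroups generated by the elements g^(2^i) are moved to the same subgroup
    by powers of T, say those for i < j.  With a = g^(2^i), some automorphism U
    then satisfies (U a)^n = a or a^-1 for an n >= 2.  Iterating, every U^m a
    is a root of a or of a^-1, so finiteness of roots forces a = U^r a for some
    r > 0, whence a^(n^r) = a or a^-1, contradicting infinite order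
    ([aut_image_not_root]). *)

(** * Cyclic subgroups *)

Section Cyclic.
Variable G : groupType.
Implicit Types (x y : G) (m n : nat).

Definition int_powers x : set G :=
  [set y | exists n : nat, y = (x ^+ n)%g \/ y = (x ^- n)%g].

Lemma int_powers1 x : int_powers x 1%g.
Proof. by exists 0%N; left. Qed.

Lemma int_powersV x y : int_powers x y -> int_powers x (y^-1)%g.
Proof.
by move=> [n [] ->]; exists n; [right|left; rewrite invgK].
Qed.

Lemma int_powers_div x m n : int_powers x (x ^+ m * x ^- n)%g.
Proof.
have [nm|/ltnW mn] := leqP n m.
  by exists (m - n)%N; left; rewrite expgnFr.
by exists (n - m)%N; right; rewrite expgnFr// invgF.
Qed.

Lemma int_powersM x y z :
  int_powers x y -> int_powers x z -> int_powers x (y * z)%g.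
Proof.
move=> [m [] ->] [n [] ->].
- by exists (m + n)%N; left; rewrite expgnDr.
- exact: int_powers_div.
- have -> : (x ^- m * x ^+ n)%g = (x ^+ n * x ^- m)%g.
    by rewrite -expVgn; apply/commuteX2/commute_sym/commuteV.
  exact: int_powers_div.
- by exists (n + m)%N; right; rewrite expgnDr invgM.
Qed.

Definition cycle_subgroup x : subgroup G :=
  Subgroup (int_powers1 x) (@int_powersM x) (@int_powersV x).

Lemma cycle_subgroup_cyclic x : is_cyclic (cycle_subgroup x).
Proof. by exists x. Qed.

Definition cycle x : cyclic_subgroup G :=
  exist _ (cycle_subgroup x) (mem_set (cycle_subgroup_cyclic x)).

Lemma cycle_id x : subgroup_set (cycle_subgroup x) x.
Proof. by exists 1%N; left. Qed.

Lemma cycle_gen (H : cyclic_subgroup G) x :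
  set_val H = int_powers x :> set G -> H = cycle x.
Proof. by move=> Hx; apply: val_inj; apply: subgroup_inj. Qed.

Lemma int_powers_inv x : int_powers (x^-1)%g = int_powers x.
Proof.
have sub z : int_powers (z^-1)%g `<=` int_powers z.
  by move=> y [n]; rewrite expVgn invgK => -[] ->; exists n; [right|left].
by apply/seteqP; split; [exact: sub|rewrite -{1}(invgK x); exact: sub].
Qed.

Lemma cycle_inv x : cycle (x^-1)%g = cycle x.
Proof. by apply: cycle_gen => /=; rewrite int_powers_inv. Qed.

End Cyclic.

(** * Neighbourhoods of the trivial subgroup *)

Section Neighbourhoods.
Variable G : groupType.
Hypothesis roots_finite : forall g : G, finite_set (root_set g).

(** A generator can be replaced by its inverse to make the exponent that
    reaches g non-negative, and g <> 1 excludes the exponent 0. *)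
Lemma cyclic_root (H : cyclic_subgroup G) (g : G) :
  g <> 1%g -> subgroup_set (set_val H) g ->
  exists2 x, root_set g x & H = cycle x.
Proof.
move=> g1 Hg; have [x Hx] := set_valP H.
have := Hg; rewrite Hx => -[[|n] [] gE].
- by rewrite gE in g1.
- by rewrite gE invg1 in g1.
- by exists x; [exists n.+1|exact: cycle_gen].
- exists (x^-1)%g; first by exists n.+1; rewrite // expVgn.
  by rewrite cycle_inv; exact: cycle_gen.
Qed.

Lemma cyclic_meeting_finite (K : set G) : finite_set K -> ~ K 1%g ->
  finite_set [set H : cyclic_subgroup G | set_val H `&` K !=set0].
Proof.
move=> Kfin K1.
apply: (@sub_finite_set _ _ (@cycle G @` \bigcup_(g in K) root_set g)).
  move=> H [g [Hg Kg]].
  have [|x gx ->] := cyclic_root _ Hg; first by move=> g1; rewrite g1 in Kg.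
  by exists x => //; exists g.
by apply: finite_image; apply: bigcup_finite.
Qed.

(** It suffices to treat sub-basic neighbourhoods, since a finite intersection
    of sets with finite complement has finite complement. *)
Lemma subbase_cofinite (B : set (subgroup G)) :
  chabauty_subbase B -> B (trivial_subgroup G) ->
  finite_set [set H : cyclic_subgroup G | ~ B (set_val H)].
Proof.
case=> [[K Kfin <-] /seteqP[K0 _]|[U _ <-] [_ [/= -> U1]]].
  apply: sub_finite_set (cyclic_meeting_finite Kfin _) => [H /= HK|K1].
    by apply/set0P/eqP.
  by apply: (K0 1%g).
apply: sub_finite_set (finite_set0 _) => H /=; apply.
by exists 1%g; split=> //; exact: subgroup1.
Qed.

(** Unfolds the topology generated by the sub-basis: an open set contains a
    finite intersection of sub-basic sets around each of its points. *)
Lemma chabauty_open_finI (B : set (subgroup G)) (H : subgroup G) :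
  open B -> B H ->
  exists J : set (set (subgroup G)),
    [/\ finite_set J, J `<=` @chabauty_subbase G,
        (forall C, J C -> C H) & \bigcap_(C in J) C `<=` B].
Proof.
move=> [D sD <-] [A DA AH]; have [I sI IA] := sD _ DA.
eexists; split; first exact: (finite_fset I).
- by move=> C CI; have := sI _ CI; rewrite inE.
- by move: AH; rewrite -IA => AH C CI; exact: (AH C CI).
- by move=> K KI; exists A => //; rewrite -IA.
Qed.

Lemma nbhs_trivial_cofinite (V : set (cyclic_subgroup G)) :
  nbhs (trivial_cyclic G) V -> finite_set (~` V).
Proof.
rewrite nbhsE => -[_ [[B oB <-] /= Bt] BV].
have [J [Jfin Jsub Jt JB]] := chabauty_open_finI oB Bt.
pose miss (C : set (subgroup G)) :=
  [set H : cyclic_subgroup G | ~ C (set_val H)].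
apply: (@sub_finite_set _ _ (\bigcup_(C in J) miss C)).
  move=> H nV; apply: contrapT => nJ; apply/nV/BV/JB => C CJ.
  by apply: contrapT => nC; apply: nJ; exists C.
apply: bigcup_finite => // C CJ.
by apply: subbase_cofinite; [exact: Jsub|exact: Jt].
Qed.

End Neighbourhoods.

(** * Automorphisms and roots *)

Lemma finite_range_repeat (T : Type) (u : nat -> T) :
  finite_set (range u) -> exists i j, (i < j)%N /\ u i = u j.
Proof.
move=> /finite_range_cst_subsequence[x [A Ainf Au]].
have [i Ai] := infinite_setN0 Ainf.
have [j Aj ij] : exists2 j, A j & (i < j)%N.
  apply: contrapT => nj; apply: Ainf.
  apply: sub_finite_set (finite_II i.+1) => k Ak /=.
  by rewrite ltnS leqNgt; apply/negP => ik; apply: nj; exists k.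
by exists i, j; split=> //; rewrite (Au i).1// (Au j).1.
Qed.

Section Automorphisms.
Variable G : groupType.
Implicit Types S T U : automorphism G.

Definition infinite_order (a : G) : Prop :=
  forall n : nat, (0 < n)%N -> (a ^+ n)%g <> 1%g.

Lemma infinite_orderX a n :
  (0 < n)%N -> infinite_order a -> infinite_order (a ^+ n)%g.
Proof.
by move=> n0 a_inf m m0; rewrite -expgnA; apply: a_inf; rewrite muln_gt0 n0.
Qed.

Lemma infinite_order_powers a n : infinite_order a -> (1 < n)%N ->
  (a ^+ n)%g <> a /\ (a ^+ n)%g <> (a^-1)%g.
Proof.
move=> a_inf n1; split=> an.
  apply: (a_inf (n - 1)%N); first by rewrite subn_gt0.
  by rewrite expgnFr ?(ltnW n1)// an expg1 mulgV.
by apply: (a_inf n.+1) => //; rewrite expgS an mulgV.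
Qed.

(** An automorphism cannot send an element of infinite order to one of its
    proper roots, up to inversion: its images under the iterates of U would be
    infinitely many roots of it and of its inverse. *)
Lemma aut_image_not_root U a n :
  finite_set (root_set a) -> finite_set (root_set (a^-1)%g) ->
  infinite_order a -> (1 < n)%N ->
  ~ ((U a ^+ n)%g = a \/ (U a ^+ n)%g = (a^-1)%g).
Proof.
move=> fin_a fin_aV a_inf n1 Uan.
have rootU m : (iter m U a ^+ (n ^ m))%g = a \/
               (iter m U a ^+ (n ^ m))%g = (a^-1)%g.
  elim: m => [|m IH]; first by left.
  rewrite iterS expnSr expgnA -autXg.
  case: IH => ->; rewrite ?autVg ?expVgn; first exact: Uan.
  by case: Uan => ->; [right|left; rewrite invgK].
have iter_inj m : injective (iter m U).
  by elim: m => [|m IH] x y //= /(can_inj (autK U)) /IH.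
have : finite_set (range (fun m => iter m U a)).
  apply: (@sub_finite_set _ _ (root_set a `|` root_set (a^-1)%g)).
    move=> _ [m _ <-].
    by case: (rootU m) => E; [left|right];
      exists (n ^ m)%N => //; rewrite expn_gt0 (ltnW n1).
  by rewrite finite_setU.
move=> /finite_range_repeat[i [j [ij]]].
rewrite -(subnKC (ltnW ij)) iterD => /(iter_inj i) aE.
have := rootU (j - i)%N; rewrite -aE.
have [|nE nEV] := @infinite_order_powers a (n ^ (j - i)) a_inf.
  by rewrite -[X in (X < _)%N](expn0 n) ltn_exp2l// subn_gt0.
by case.
Qed.

Definition aut_id : automorphism G :=
  @Automorphism G (idfun : {multiplicative G -> G}) idfun
    (fun=> erefl) (fun=> erefl).

Definition aut_comp S T : automorphism G :=
  @Automorphism G (S \o T : {multiplicative G -> G}) (autV T \o autV S)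
    (can_comp (autK S) (autK T)) (can_comp (autVK T) (autVK S)).

Lemma aut_image_id H : aut_image aut_id H = H.
Proof. by apply: subgroup_inj; rewrite /= image_id. Qed.

Lemma aut_image_comp S T H :
  aut_image (aut_comp S T) H = aut_image S (aut_image T H).
Proof. by apply: subgroup_inj; rewrite /= image_comp. Qed.

Lemma homeo_iter_aut_image T (n : int) :
  exists A : automorphism G, forall H : cyclic_subgroup G,
    set_val (homeo_iter (cyclic_homeo T) n H) = aut_image A (set_val H).
Proof.
have iter_aut S m : exists A : automorphism G, forall H : cyclic_subgroup G,
    set_val (iter m (cyclic_image S) H) = aut_image A (set_val H).
  elim: m => [|m [A AE]]; first by exists aut_id => H; rewrite aut_image_id.
  by exists (aut_comp S A) => H; rewrite aut_image_comp -AE.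
case: n => m; first exact: (iter_aut T m).
exact: (iter_aut (aut_inv T) m.+1).
Qed.

Lemma aut_image_trivial T :
  aut_image T (trivial_subgroup G) = trivial_subgroup G.
Proof. by apply: subgroup_inj; rewrite /= image_set1 aut1. Qed.

End Automorphisms.

(** * Expansiveness *)

(** The trivial subgroup is fixed, so the orbit of any other point must move
    delta away from it.  The iterate of T that does so depends on H; it is
    recorded as an automorphism A because two such iterates will be combined
    into a single automorphism. *)
Lemma expansive_orbits_meet_finite (R : realType) (G : groupType)
    (T : automorphism G) :
  (forall V : set (cyclic_subgroup G),
     nbhs (trivial_cyclic G) V -> finite_set (~` V)) ->
  acts_expansively R T ->
  exists2 F : set (subgroup G), finite_set F &
    forall H : cyclic_subgroup G, H <> trivial_cyclic G ->
      exists A : automorphism G, F (aut_image A (set_val H)).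
Proof.
move=> cofin [d dm [delta delta0 dexp]].
set B := [set H | (d (trivial_cyclic G) H < delta)%R].
have Bn : nbhs (trivial_cyclic G) B by apply/(metric_nbhs dm); exists delta.
exists (set_val @` ~` B); first exact/finite_image/cofin.
move=> H Ht; have [n] := dexp _ _ Ht.
have [A AE] := homeo_iter_aut_image T n.
have -> : homeo_iter (cyclic_homeo T) n (trivial_cyclic G) = trivial_cyclic G.
  by apply: val_inj; rewrite /= [LHS]AE aut_image_trivial.
move=> far; exists A, (homeo_iter (cyclic_homeo T) n H) => //.
rewrite /B /= (metric_symm dm); apply/negP.
by rewrite -Order.TotalTheory.leNgt Order.POrderTheory.ltW.
Qed.

Lemma infinite_order_exists (G : groupType) :
  finite_set (root_set (1%g : G)) -> ~ finite_set [set: G] ->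
  exists g : G, infinite_order g.
Proof.
move=> tors Ginf; apply: contrapT => nog; apply: Ginf.
apply: sub_finite_set tors => g _; apply: contrapT => ng; apply: nog.
by exists g => n n0 gn; apply: ng; exists n.
Qed.

(** * The theorem *)

Theorem lemma5p1 (R : realType) (G : groupType)
  (Sub_metrizable : metrizable R (subgroup G))
  (roots_finite : forall g : G, finite_set (root_set g)) :
  (forall V : set (cyclic_subgroup G),
     nbhs (trivial_cyclic G) V -> finite_set (~` V)) /\
  (~ finite_set [set: G] ->
     ~ exists T : automorphism G, acts_expansively R T).
Proof.
have cofin := nbhs_trivial_cofinite roots_finite.
split=> // Ginf [T /(expansive_orbits_meet_finite cofin)[F Ffin Forb]].
have [g g_inf] := infinite_order_exists (roots_finite 1%g) Ginf.
have pow_inf i : infinite_order (g ^+ (2 ^ i))%g.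
  by apply: infinite_orderX => //; rewrite expn_gt0.
have /choice[A FA] i : exists A : automorphism G,
    F (aut_image A (cycle_subgroup (g ^+ (2 ^ i))%g)).
  apply: (Forb (cycle (g ^+ (2 ^ i))%g)) => /(congr1 val) /= cyc1.
  apply: (pow_inf i 1%N) => //.
  by have := cycle_id (g ^+ (2 ^ i))%g; rewrite cyc1.
have [i [j [ij AE]]] : exists i j, (i < j)%N /\
    aut_image (A i) (cycle_subgroup (g ^+ (2 ^ i))%g) =
    aut_image (A j) (cycle_subgroup (g ^+ (2 ^ j))%g).
  by apply: finite_range_repeat; apply: sub_finite_set Ffin => _ [i _ <-].
set a := (g ^+ (2 ^ i))%g in AE.
have jE : (g ^+ (2 ^ j))%g = (a ^+ (2 ^ (j - i)))%g.
  by rewrite -expgnA -expnD subnKC// ltnW.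
have : subgroup_set (aut_image (A i) (cycle_subgroup a)) (A i a).
  by exists a => //; exact: cycle_id.
rewrite AE jE => -[c [k kE] AjE].
have k0 : (0 < k)%N.
  case: k kE AjE => // -[] ->; rewrite ?expg0 ?invg1 aut1 -(aut1 (A i)) =>
    /(can_inj (autK _)) a1; by case: (pow_inf i 1%N).
(* Applying the inverse of A i to A i a = A j (a ^+ (2 ^ (j - i) * k)), up to
   inversion, exhibits a as a proper power of (A i)^-1 (A j a). *)
apply: (@aut_image_not_root _ (aut_comp (aut_inv (A i)) (A j)) a
         (2 ^ (j - i) * k)) => //.
- exact: pow_inf.
- rewrite (leq_trans _ (leq_pmulr _ k0))//.
  by rewrite -[X in (X < _)%N](expn0 2) ltn_exp2l// subn_gt0.
rewrite -autXg expgnA /=.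
case: kE AjE => ->; rewrite ?autVg.
  by move=> ->; left; rewrite autK.
by move=> /(canRL (@invgK G)) ->; right; rewrite -autVg autK.
Qed.
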